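(* Let $n\ge1$, $\delta\in\mathbb{N}^n$, and let $p$ be a real polynomial in $n$ variables of multi-degree at most $\delta$ with Bernstein coefficients $(b_{I,\delta})_{I\le\delta}$. Let $p^*=\min_{x\in[0,1]^n}p(x)$. Consider any one of the three linear programs $(\mathrm{LP}_0)$, $(\mathrm{LP}_1)$, $(\mathrm{LP}_2)$ defined in the context, let $p_\delta^*$ be its optimal value, and let $z_\delta^*=(z_{I,\delta}^* )_{I\le\delta}$ be the degree-$\delta$ components of an optimal solution. If there exists $x^*\in[0,1]^n$ such that $$(x^* )^I=\sum_{0\le J\le\delta}\frac{\binom{J}{I}}{\binom{\delta}{I}}\,z_{J,\delta}^*\qquad\text{for all } I\le\delta,$$ then the relaxation is exact, i.e. $p^*=p_\delta^*$, and $x^*$ is a global minimizer of $p$ over $[0,1]^n$.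
   Context: Multi-index notation: for $I=(i_1,\dots,i_n),J=(j_1,\dots,j_n)\in\mathbb{N}^n$, $I\le J$ means $i_l\le j_l$ for all $l$; $x^I=x_1^{i_1}\cdots x_n^{i_n}$; $\binom{I}{J}=\prod_{l}\binom{i_l}{j_l}$, which is $0$ unless $J\le I$; $\frac{I}{J}=(i_1/j_1,\dots,i_n/j_n)$ (with the convention $0/0=0$); for $r\in\{1,\dots,n\}$ and $k\in\mathbb{Z}$, $I_{r,k}=(i_1,\dots,i_{r-1},i_r+k,i_{r+1},\dots,i_n)$. Bernstein polynomials: for $I\le K$ in $\mathbb{N}^n$, $B_{I,K}(x)=\prod_{l=1}^n\binom{K_l}{i_l}x_l^{i_l}(1-x_l)^{K_l-i_l}$. The Bernstein coefficients of $p=\sum_{I\le\delta}p_Ix^I$ are $b_{I,\delta}=\sum_{J\le I}\frac{\binom{I}{J}}{\binom{\delta}{J}}p_J$, so that $p=\sum_{I\le\delta}b_{I,\delta}B_{I,\delta}$. Linear programs (relaxations of the problem of minimizing $p$ over $[0,1]^n$): $(\mathrm{LP}_0)$: minimize $\sum_{I\le\delta}b_{I,\delta}z_{I,\delta}$ over reals $z_{I,\delta}$ ($I\le\delta$) subject to $z_{I,\delta}\ge0$ for all $I\le\delta$ and $\sum_{I\le\delta}z_{I,\delta}=1$. $(\mathrm{LP}_1)$: the same as $(\mathrm{LP}_0)$ with the additional constraints $z_{I,\delta}\le B_{I,\delta}\left(\frac{I}{\delta}\right)$ for all $I\le\delta$. $(\mathrm{LP}_2)$: minimize $\sum_{I\le\delta}b_{I,\delta}z_{I,\delta}$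 over reals $z_{I,K}$ (for all $K\le\delta$ and $I\le K$) subject to: $0\le z_{I,K}\le B_{I,K}\left(\frac{I}{K}\right)$ for all $I\le K\le\delta$; $\sum_{I\le K}z_{I,K}=1$ for all $K\le\delta$; and $$z_{I,K_{r,-1}}=\frac{K_r-i_r}{K_r}z_{I,K}+\frac{i_r+1}{K_r}z_{I_{r,1},K}$$ for all $K\le\delta$, all $I\le K$ and all $r\in\{1,\dots,n\}$ with $I_{r,1}\le K$. *)

(* Defs.v *)
From mathcomp Require Import all_boot all_order all_algebra.
From mathcomp Require Import classical_sets reals.
From mathcomp Require Import mpoly.

Set Implicit Arguments.
Unset Strict Implicit.
Unset Printing Implicit Defensive.

Import Order.TTheory GRing.Theory Num.Theory.

Local Open Scope classical_set_scope.
Local Open Scope ring_scope.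

(* Multi-indices are the monomials 'X_{1..n}, and (I <= K)%MM is the           *)
(* componentwise order. A sum over all I <= K is written                      *)
(*   \sum_(I : 'X_{1..n < (mdeg K).+1} | (I <= K)%MM) F I                     *)
(* which loses no index, since (I <= K)%MM implies mdeg I <= mdeg K.          *)

Section Minimization.
Variables (R : realType) (T : Type).
Implicit Types (f : T -> R) (A : set T).

(* The infimum is used to have a total function; it is the minimum as soon as *)
(* the latter exists (min_valueE).                                            *)
Definition min_value f A : R := inf [set f x | x in A].

Definition is_minimizer f A (x : T) : Prop :=
  A x /\ forall y, A y -> f x <= f y.

Lemma min_valueE f A x : is_minimizer f A x -> min_value f A = f x.
Proof.
move=> [Ax xmin]; apply/eqP; rewrite eq_le; apply/andP; split.
  by apply: ge_inf; [exists (f x) => _ [y Ay <-]; exact: xmin | exists x].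
by apply: lb_le_inf; [exists (f x), x | move=> _ [y Ay <-]; exact: xmin].
Qed.

End Minimization.

Section Bernstein.
Variables (R : realType) (n : nat).
Implicit Types (I J K delta : 'X_{1..n}) (x : 'I_n -> R) (p : {mpoly R[n]}).

Definition unit_box : set ('I_n -> R) := [set x | forall l, 0 <= x l <= 1].

Definition mpow x I : R := \prod_(l < n) x l ^+ I l.

Definition mbin I J : nat := \prod_(l < n) 'C(I l, J l).

(* 0 / 0 = 0 since 0^-1 = 0 *)
Definition mdivr I J : 'I_n -> R := fun l => (I l)%:R / (J l)%:R.

Definition bernstein I K x : R :=
  \prod_(l < n) ('C(K l, I l)%:R * x l ^+ I l * (1 - x l) ^+ (K l - I l)).

Definition multidegree_le p delta : Prop :=
  forall m, m \in msupp p -> (m <= delta)%MM.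

Definition bernstein_coef delta p I : R :=
  \sum_(J : 'X_{1..n < (mdeg I).+1} | (J <= I)%MM)
     (mbin I J)%:R / (mbin delta J)%:R * p@_J.

End Bernstein.

Variant relaxation := LP0 | LP1 | LP2.

Section Relaxations.
Variables (R : realType) (n : nat).
Implicit Types (I K delta : 'X_{1..n}).

Definition lp0_feasible delta : set ('X_{1..n} -> R) := [set z |
  (forall I, (I <= delta)%MM -> 0 <= z I) /\
  \sum_(I : 'X_{1..n < (mdeg delta).+1} | (I <= delta)%MM) z I = 1].

Definition lp1_feasible delta : set ('X_{1..n} -> R) := [set z |
  lp0_feasible delta z /\
  forall I, (I <= delta)%MM -> z I <= bernstein I delta (mdivr R I delta)].

(* K - U_(r) does not truncate: I + U_(r) <= K forces 0 < K r. *)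
Definition lp2_feasible delta : set ('X_{1..n} -> 'X_{1..n} -> R) := [set z |
  [/\ forall K I, (K <= delta)%MM -> (I <= K)%MM ->
        0 <= z I K <= bernstein I K (mdivr R I K),
      forall K, (K <= delta)%MM ->
        \sum_(I : 'X_{1..n < (mdeg K).+1} | (I <= K)%MM) z I K = 1
    & forall K I (r : 'I_n), (K <= delta)%MM -> (I <= K)%MM ->
        (I + U_(r) <= K)%MM ->
        z I (K - U_(r))%MM =
          ((K r)%:R - (I r)%:R) / (K r)%:R * z I K
          + (I r).+1%:R / (K r)%:R * z (I + U_(r))%MM K]].

(* The unknowns are the z I (I <= delta) for LP0 and LP1, and the z I K       *)
(* (I <= K <= delta) for LP2. They are extended to total functions; the       *)
(* constraints and the objective never read the other values.                 *)
Definition lp_var (i : relaxation) : Type :=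
  if i is LP2 then 'X_{1..n} -> 'X_{1..n} -> R else 'X_{1..n} -> R.

Definition lp_feasible delta (i : relaxation) : set (lp_var i) :=
  match i return set (lp_var i) with
  | LP0 => lp0_feasible delta
  | LP1 => lp1_feasible delta
  | LP2 => lp2_feasible delta
  end.

(* the components of degree delta *)
Definition lp_top delta (i : relaxation) : lp_var i -> 'X_{1..n} -> R :=
  match i return lp_var i -> 'X_{1..n} -> R with
  | LP2 => fun z I => z I delta
  | _ => fun z => z
  end.

Definition lp_objective delta (p : {mpoly R[n]}) (i : relaxation)
    (z : lp_var i) : R :=
  \sum_(I : 'X_{1..n < (mdeg delta).+1} | (I <= delta)%MM)
     bernstein_coef delta p I * lp_top delta z I.

End Relaxations.

Arguments unit_box R n : clear implicits.
Arguments lp_var R n i : clear implicits.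
Arguments lp_feasible R {n} delta i.
Arguments lp_objective {R n} delta p i z.

(* Main.v *)
Require Import Defs.
From mathcomp Require Import all_boot all_order all_algebra.
From mathcomp Require Import classical_sets reals.
From mathcomp Require Import mpoly.
From mathcomp Require Import ring.

Import Order.TTheory GRing.Theory Num.Theory.
Local Open Scope ring_scope.

(** The objective of each program depends on z only through its moments: for
    I <= delta, the I-th moment of a family w indexed by J <= delta is
      \sum_(J <= delta) (mbin J I) / (mbin delta I) * w J,
    and, once the Bernstein coefficients are expanded and the two sums
    exchanged, the objective is the sum of p_I times the I-th moment. So if the
    moments of z are the monomials x^I, then the objective at z is p(x)
    ([lp_objective_moments]).

    Every point y of the box provides a family whose moments are the y^I: the
    values at y of the Bernstein polynomials themselves ([mpow_moment]). It
    satisfies the constraints of all three programs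
    ([bernstein_point_feasible]): Bernstein polynomials are nonnegative on the
    box and sum to 1, B_(I,K) is maximal at I / K, and the equations of the
    third program are the degree-lowering relations of the Bernstein basis. So
    p(y) is the value of the objective at a feasible point, and optimality of z
    gives p(x) <= p(y) for all y in the box: x is a minimizer, and both minima
    are equal to p(x).

    All facts about Bernstein polynomials reduce to one variable, since
    B_(I,K) is a product over the coordinates and a sum of such products over
    I <= K is the product of the one-variable sums ([sum_prod_below]). *)

(** * Bernstein polynomials in one variable *)

(** Both sides count the ways of splitting a set of i + a + b elements into
    parts of i, a and b elements. *)
Lemma bin_mul_bin (i a b : nat) :
  ('C(i + a, i) * 'C(i + (a + b), i + a) = 'C(i + (a + b), i) * 'C(a + b, a))%N.
Proof.
have e0 := bin_fact (leq_addr a i); have e1 := bin_fact (leq_addr (a + b) i).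
have e2 := bin_fact (leq_addr b a); have e3 := bin_fact (leq_addr b (i + a)).
rewrite -addnA in e3; rewrite !addKn in e0 e1 e2.
rewrite [in (_ - _)%N]addnA addKn in e3.
apply/eqP; rewrite -(eqn_pmul2r (fact_gt0 i)) -(eqn_pmul2r (fact_gt0 a)).
rewrite -(eqn_pmul2r (fact_gt0 b)); apply/eqP.
transitivity (i + (a + b))`!.
  by rewrite -[RHS]e3 -e0; ring.
by rewrite -[LHS]e1 -e2; ring.
Qed.

Section Univariate.
Variable R : realFieldType.
Implicit Types (t s : R) (i j k : nat).

Definition bernstein1 i k t : R := 'C(k, i)%:R * t ^+ i * (1 - t) ^+ (k - i).

Lemma bernstein1_ge0 i k t : 0 <= t <= 1 -> 0 <= bernstein1 i k t.
Proof.
by move=> /andP[t0 t1]; rewrite !mulr_ge0 ?exprn_ge0 ?subr_ge0 ?ler0n.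
Qed.

(** The trinomial identity [bin_mul_bin] turns each term with i <= j into t^i
    times a term of the expansion of (1 - t + t)^(k - i) = 1; the terms with
    j < i vanish. *)
Lemma expr_moment1 i k t : (i <= k)%N ->
  \sum_(j < k.+1) 'C(j, i)%:R / 'C(k, i)%:R * bernstein1 j k t = t ^+ i.
Proof.
move=> /subnKC <-; set b := (k - i)%N.
have bin_neq0 : 'C(i + b, i)%:R != 0 :> R.
  by rewrite pnatr_eq0 -lt0n bin_gt0 leq_addr.
rewrite -addnS big_split_ord /= big1 ?add0r => [|j _]; last first.
  by rewrite bin_small ?mul0r.
transitivity (t ^+ i * (1 - t + t) ^+ b); last by rewrite subrK expr1n mulr1.
rewrite exprDn mulr_sumr.
apply: eq_bigr => -[a /= le_ab] _; have {}le_ab : (a <= b)%N by [].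
rewrite /bernstein1 subnDl -[in 'C(i + b, i + a)](subnKC le_ab).
rewrite -[_ *+ 'C(b, a)]mulr_natl.
have := congr1 (fun m : nat => m%:R : R) (bin_mul_bin i a (b - a)).
rewrite (subnKC le_ab) !natrM exprD => e.
transitivity (('C(i + a, i)%:R * 'C(i + b, i + a)%:R) / 'C(i + b, i)%:R
   * (t ^+ i * t ^+ a * (1 - t) ^+ (b - a))); first by ring.
by rewrite e; field.
Qed.

(** The inequality between the geometric and the arithmetic mean for i copies
    of t / i and j copies of s / j, cleared of denominators. When i or j is 0
    one of the two groups is empty, and monotonicity of powers is enough. *)
Lemma expr_mul_le_AGM i j t s : 0 <= t -> 0 <= s ->
  t ^+ i * s ^+ j * (i + j)%:R ^+ (i + j)
    <= i%:R ^+ i * j%:R ^+ j * (t + s) ^+ (i + j).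
Proof.
move=> t0 s0; case: (posnP i) => [->|i0].
  rewrite !expr0 !mul1r add0n mulrC ler_wpM2l ?exprn_ge0 ?ler0n //.
  by rewrite lerXn2r ?nnegrE ?addr_ge0 // lerDr.
case: (posnP j) => [->|j0].
  rewrite !expr0 !mulr1 addn0 mulrC ler_wpM2l ?exprn_ge0 ?ler0n //.
  by rewrite lerXn2r ?nnegrE ?addr_ge0 // lerDl.
have iR : i%:R != 0 :> R by rewrite pnatr_eq0 -lt0n.
have jR : j%:R != 0 :> R by rewrite pnatr_eq0 -lt0n.
pose E (l : 'I_(i + j)) := if (l < i)%N then t / i%:R else s / j%:R.
have E_ge0 l : 0 <= E l by rewrite /E; case: ifP; rewrite divr_ge0 ?ler0n.
have E_l l : E (lshift j l) = t / i%:R by rewrite /E /= ltn_ord.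
have E_r l : E (rshift i l) = s / j%:R by rewrite /E /= ltnNge leq_addr.
have [] := @leif_AGM_scaled R _ predT E (fun l _ => mulrn_wge0 _ (E_ge0 l)).
have -> : #|{: 'I_(i + j)}| = (i + j)%N by rewrite card_ord.
rewrite !big_split_ord /=.
under eq_bigr do rewrite E_l.
under [X in _ * X]eq_bigr do rewrite E_r.
under [X in (X + _) ^+ _]eq_bigr do rewrite E_l.
under [X in (_ + X) ^+ _]eq_bigr do rewrite E_r.
rewrite !prodr_const !sumr_const !card_ord -[_ / _ *+ i]mulr_natr.
rewrite -[_ / _ *+ j]mulr_natr !divfK // => le_prod _.
have ij0 : 0 <= i%:R ^+ i * j%:R ^+ j :> R by rewrite mulr_ge0 ?exprn_ge0.
apply: le_trans (ler_wpM2l ij0 le_prod).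
rewrite -![_ / _ *+ (i + j)]mulr_natr !exprMn exprD !exprVn le_eqVlt.
apply/orP; left; apply/eqP; field.
by rewrite !expf_neq0.
Qed.

(** This is [expr_mul_le_AGM] at s = 1 - t, where the sum t + s is 1, divided by
    k^k. For k = 0 the polynomial is the constant 1. *)
Lemma bernstein1_le_argmax i k t : (i <= k)%N -> 0 <= t <= 1 ->
  bernstein1 i k t <= bernstein1 i k (i%:R / k%:R).
Proof.
move=> le_ik /andP[t0 t1]; rewrite /bernstein1 -!mulrA ler_wpM2l ?ler0n //.
case: (posnP k) => [k0|k_gt0].
  by move: le_ik; rewrite k0 leqn0 => /eqP->; rewrite subnn !expr0.
have kR : k%:R != 0 :> R by rewrite pnatr_eq0 -lt0n.
have -> : 1 - i%:R / k%:R = (k - i)%:R / k%:R :> R.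
  by rewrite natrB //; field.
rewrite !exprMn mulrACA -exprD subnKC // exprVn ler_pdivlMr ?exprn_gt0 ?ltr0n //.
have := @expr_mul_le_AGM i (k - i) t (1 - t) t0; rewrite subr_ge0 subnKC //.
by move=> /(_ t1); rewrite [t + _]addrC subrK expr1n mulr1.
Qed.

(** Multiplying B_(i,k) by (1 - t) + t raises its degree, and each of the two
    products is a multiple of a basis element of degree k + 1. *)
Lemma bernstein1_degree_lowering i k t : (i <= k)%N ->
  bernstein1 i k t = (k.+1%:R - i%:R) / k.+1%:R * bernstein1 i k.+1 t
                     + i.+1%:R / k.+1%:R * bernstein1 i.+1 k.+1 t.
Proof.
move=> le_ik; have kR : k.+1%:R != 0 :> R by rewrite pnatr_eq0.
have down : (k.+1%:R - i%:R) * 'C(k.+1, i)%:R = k.+1%:R * 'C(k, i)%:R :> R.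
  by rewrite -natrB ?leqW // -!natrM -mul_bin_down.
have diag : i.+1%:R * 'C(k.+1, i.+1)%:R = k.+1%:R * 'C(k, i)%:R :> R.
  by rewrite -!natrM -mul_bin_diag.
rewrite /bernstein1 subSS subSn // !exprS.
transitivity (((k.+1%:R - i%:R) * 'C(k.+1, i)%:R * (1 - t)
   + i.+1%:R * 'C(k.+1, i.+1)%:R * t) / k.+1%:R
     * (t ^+ i * (1 - t) ^+ (k - i))); last by ring.
by rewrite down diag; field; rewrite addrC natr1.
Qed.

End Univariate.

(** * From one variable to several *)

(** Distributivity, read through the bijection between the multi-indices
    I <= K and the finite functions g with g l <= K l for all l. Both are
    coded with the common bound mdeg K, which dominates every component of an
    I <= K. *)
Lemma sum_prod_below (R : comNzSemiRingType) (n : nat) (K : 'X_{1..n})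
    (f : 'I_n -> nat -> R) :
  \sum_(I : 'X_{1..n < (mdeg K).+1} | (I <= K)%MM) \prod_(l < n) f l (I l)
    = \prod_(l < n) \sum_(j < (K l).+1) f l j.
Proof.
have K_le l : (K l <= mdeg K)%N by rewrite mdegE (bigD1 l) //= leq_addr.
under [RHS]eq_bigr => l _.
  rewrite (big_ord_widen (mdeg K).+1) ?ltnS //; over.
rewrite bigA_distr_big_dep /=.
pose h (I : 'X_{1..n < (mdeg K).+1}) : {ffun 'I_n -> 'I_(mdeg K).+1} :=
  [ffun l => inord (I l)].
pose h' (g : {ffun 'I_n -> 'I_(mdeg K).+1}) : 'X_{1..n < (mdeg K).+1} :=
  insubd (BMultinom (ltnSn (mdeg K))) [multinom (g l : nat) | l < n].
have h'E (g : {ffun 'I_n -> 'I_(mdeg K).+1}) :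
    g \in family (fun l (j : 'I_(mdeg K).+1) => (j < (K l).+1)%N) ->
    bmnm (h' g) = [multinom (g l : nat) | l < n].
  move=> /familyP gP; rewrite /h' [LHS]val_insubd ifT //.
  rewrite ltnS mdegE [leqRHS]mdegE leq_sum //.
  by move=> l _; rewrite mnmE; exact: gP.
have I_lt (I : 'X_{1..n < (mdeg K).+1}) l : (I l < (mdeg K).+1)%N.
  case: I => I /= I_lt; apply: leq_ltn_trans I_lt.
  by rewrite mdegE (bigD1 l) //= leq_addr.
rewrite [RHS](reindex_onto h h') => [|g gP]; last first.
  by apply/ffunP => l; apply/val_inj; rewrite ffunE /= h'E // mnmE inordK.
apply: eq_big => [I|I leIK]; last first.
  by apply: eq_bigr => l _; rewrite ffunE inordK.
have hE : (h I \in family (fun l (j : 'I_(mdeg K).+1) => (j < (K l).+1)%N))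
          = (I <= K)%MM.
  by apply/familyP/mnm_lepP => H l; have := H l;
    rewrite ffunE unfold_in inordK ?I_lt // ltnS.
rewrite hE; case: (boolP (I <= K)%MM) => //= leIK; apply/esym/eqP.
apply/val_inj => /=; rewrite h'E ?hE //; apply/mnmP => l.
by rewrite mnmE ffunE inordK.
Qed.

Section Multivariate.
Variables (R : realType) (n : nat).
Implicit Types (I J K delta : 'X_{1..n}) (x y : 'I_n -> R) (p : {mpoly R[n]}).

Lemma mbin_small I J : ~~ (I <= J)%MM -> mbin J I = 0%N.
Proof.
move=> /forallPn[l]; rewrite -ltnNge => lt_l.
by rewrite /mbin (bigD1 l) //= bin_small.
Qed.

Lemma bernstein_ge0 I K y : unit_box R n y -> 0 <= bernstein I K y.
Proof. by move=> y_box; apply: prodr_ge0 => l _; apply: bernstein1_ge0. Qed.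

Lemma mpow_moment I K y : (I <= K)%MM ->
  \sum_(J : 'X_{1..n < (mdeg K).+1} | (J <= K)%MM)
    (mbin J I)%:R / (mbin K I)%:R * bernstein J K y = mpow y I.
Proof.
move=> /mnm_lepP leIK.
transitivity (\prod_(l < n) \sum_(j < (K l).+1)
    'C(j, I l)%:R / 'C(K l, I l)%:R * bernstein1 R j (K l) (y l)).
  rewrite -(sum_prod_below R n K (fun l j =>
    'C(j, I l)%:R / 'C(K l, I l)%:R * bernstein1 R j (K l) (y l))).
  apply: eq_bigr => J _; rewrite /mbin !natr_prod /bernstein -prodfV.
  by rewrite -!big_split.
by apply: eq_bigr => l _; rewrite expr_moment1.
Qed.

(** The sum is the moment of index 0. *)
Lemma sum_bernstein K y :
  \sum_(J : 'X_{1..n < (mdeg K).+1} | (J <= K)%MM) bernstein J K y = 1.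
Proof.
transitivity (mpow y 0%MM); last by apply: big1 => l _; rewrite mnm0E expr0.
rewrite -(mpow_moment 0%MM K); last by apply/mnm_lepP => l; rewrite mnm0E.
apply: eq_bigr => J _; rewrite /mbin.
by rewrite !big1 ?divr1 ?mul1r // => l _; rewrite mnm0E bin0.
Qed.

Lemma bernstein_le_argmax I K y : (I <= K)%MM -> unit_box R n y ->
  bernstein I K y <= bernstein I K (mdivr R I K).
Proof.
move=> /mnm_lepP leIK y_box; apply: ler_prod => l _; apply/andP; split.
  exact: bernstein1_ge0.
exact: bernstein1_le_argmax.
Qed.

(** Only the factor of the coordinate r differs between the three polynomials,
    so this is the one-variable relation times a common product. *)
Lemma bernstein_degree_lowering I K (r : 'I_n) y : (I + U_(r) <= K)%MM ->
  bernstein I (K - U_(r))%MM y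
    = ((K r)%:R - (I r)%:R) / (K r)%:R * bernstein I K y
      + (I r).+1%:R / (K r)%:R * bernstein (I + U_(r))%MM K y.
Proof.
move=> /mnm_lepP /(_ r); rewrite mnmDE mnm1E eqxx addn1 => lt_r.
have split_r I' K' : bernstein I' K' y = bernstein1 R (I' r) (K' r) (y r)
    * \prod_(l < n | l != r) bernstein1 R (I' l) (K' l) (y l).
  by rewrite /bernstein (bigD1 r).
have off_r l : l != r -> (U_(r)%MM : 'X_{1..n}) l = 0%N.
  by rewrite mnm1E eq_sym => /negbTE->.
rewrite !split_r mnmBE mnmDE mnm1E eqxx addn1 subn1.
under eq_bigr => l lr do rewrite mnmBE off_r // subn0.
under [X in _ = _ + _ * (_ * X)]eq_bigr => l lr do rewrite mnmDE off_r // addn0.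
case: (K r) lt_r => // k; rewrite ltnS /= => le_r.
by rewrite (bernstein1_degree_lowering R _ _ _ le_r) mulrDl !mulrA.
Qed.

(** * The linear programs *)

(** Summing over the support of p makes the range independent of J, so that the
    sum can be exchanged with the sum over J in the objective. The terms with
    m not below J vanish together with mbin J m. *)
Lemma bernstein_coef_msupp delta p J :
  bernstein_coef delta p J
    = \sum_(m <- msupp p) (mbin J m)%:R / (mbin delta m)%:R * p@_m.
Proof.
pose F (m : 'X_{1..n}) := (mbin J m)%:R / (mbin delta m)%:R * p@_m.
rewrite -[LHS]/(\sum_(I : 'X_{1..n < (mdeg J).+1} | (I <= J)%MM) F (val I)).
rewrite -(big_rmcond_in (fun m : 'X_{1..n} => (m <= J)%MM)) /=; last first.
  by move=> m _ /mbin_small->; rewrite !mul0r.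
rewrite -(big_map val (fun m : 'X_{1..n} => (m <= J)%MM) F).
set s := map _ _.
rewrite (bigID (fun m => m \in msupp p)) /= [X in _ + X]big1 ?addr0; last first.
  by move=> m /andP[_ /memN_msupp_eq0 p0]; rewrite /F p0 mulr0.
rewrite -big_filter -[RHS]big_filter; apply/perm_big/uniq_perm.
- by rewrite filter_uniq // map_inj_uniq ?index_enum_uniq //; apply: val_inj.
- by rewrite filter_uniq.
move=> m; rewrite !mem_filter; case: (boolP (m <= J)%MM) => //= leJ.
rewrite andbC; suff -> : m \in s by [].
have m_lt : (mdeg m < (mdeg J).+1)%N.
  by rewrite ltnS !mdegE leq_sum // => l _; move/mnm_lepP: leJ.
by apply/mapP; exists (BMultinom m_lt) => //; rewrite mem_index_enum.
Qed.

(** The objective is the combination of the moments of z with the coefficients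
    of p; the degree bound ensures that only moments of index at most delta
    occur. *)
Lemma lp_objective_moments delta p (i : relaxation) (z : lp_var R n i) y :
  multidegree_le p delta ->
  (forall I, (I <= delta)%MM -> mpow y I =
     \sum_(J : 'X_{1..n < (mdeg delta).+1} | (J <= delta)%MM)
        (mbin J I)%:R / (mbin delta I)%:R * lp_top delta z J) ->
  lp_objective delta p i z = p.@[y].
Proof.
move=> p_delta y_moments; rewrite mevalE /lp_objective.
under eq_bigr do rewrite bernstein_coef_msupp mulr_suml.
rewrite exchange_big /=; apply: eq_big_seq => m /p_delta m_delta.
rewrite -[\prod_(_ < n) _]/(mpow y m) y_moments // mulr_sumr.
by apply: eq_bigr => J _; rewrite mulrAC mulrC.
Qed.

Definition bernstein_point delta (i : relaxation) y : lp_var R n i :=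
  match i return lp_var R n i with
  | LP2 => fun I K => bernstein I K y
  | _ => fun I => bernstein I delta y
  end.

Lemma bernstein_point_feasible delta i y : unit_box R n y ->
  lp_feasible R delta i (bernstein_point delta i y).
Proof.
move=> y_box.
have feasible0 : lp0_feasible delta (fun I => bernstein I delta y).
  by split=> [I _|]; [exact: bernstein_ge0 | exact: sum_bernstein].
case: i => //=.
  by split=> // I leI; exact: bernstein_le_argmax.
split=> [K I _ leIK|K _|K I r _ _ leK].
- by rewrite bernstein_ge0 //= bernstein_le_argmax.
- exact: sum_bernstein.
- exact: bernstein_degree_lowering.
Qed.

Lemma lp_objective_bernstein_point delta p i y : multidegree_le p delta ->
  lp_objective delta p i (bernstein_point delta i y) = p.@[y].
Proof.
move=> p_delta; apply: lp_objective_moments => // I leI.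
by rewrite -(mpow_moment I delta) //; case: i.
Qed.

End Multivariate.

Theorem proposition4 (R : realType) (n : nat) (n_gt0 : (0 < n)%N)
    (delta : 'X_{1..n}) (p : {mpoly R[n]}) (p_delta : multidegree_le p delta)
    (i : relaxation) (z : lp_var R n i)
    (z_opt : is_minimizer (lp_objective delta p i) (lp_feasible R delta i) z)
    (x : 'I_n -> R) (x_box : unit_box R n x)
    (x_moments : forall I : 'X_{1..n}, (I <= delta)%MM ->
       mpow x I =
       \sum_(J : 'X_{1..n < (mdeg delta).+1} | (J <= delta)%MM)
          (mbin J I)%:R / (mbin delta I)%:R * lp_top delta z J) :
  min_value (fun y => p.@[y]) (unit_box R n) =
    min_value (lp_objective delta p i) (lp_feasible R delta i)
  /\ is_minimizer (fun y => p.@[y]) (unit_box R n) x.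
Proof.
have obj_z : lp_objective delta p i z = p.@[x] by exact: lp_objective_moments.
have x_min : is_minimizer (fun y => p.@[y]) (unit_box R n) x.
  split=> // y y_box; have [_ z_min] := z_opt.
  rewrite -obj_z -(lp_objective_bernstein_point R n delta p i y) //.
  by apply: z_min; exact: bernstein_point_feasible.
by split=> //; rewrite (min_valueE x_min) (min_valueE z_opt) obj_z.
Qed.
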